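(* Let $\mathcal{H}$ be a balanced strongly connected $d$-uniform hypergraph, with a $d$-coloring of its vertices witnessing balancedness. Then the exact transversals of $\mathcal{H}$ are exactly the color classes of vertices.
   Context: A $d$-uniform hypergraph has edges that are $d$-element subsets of its vertex set. It is balanced if there is a coloring of its vertices with $d$ colors such that no edge contains two vertices of the same color. It is strongly connected if for every pair of edges $e,f$ there is a finite sequence of edges $e=e^{(0)},\dots,e^{(n)}=f$ in which consecutive edges have symmetric difference of cardinality two. An exact transversal is a set of vertices meeting each edge in exactly one vertex.
   Formalization: It is additionally assumed that d is positive and that every vertex lies on some edge; otherwise an isolated vertex could be removed from a color class, giving an exact transversal that is not a color class. *)

(* Defs.v *)
From mathcomp Require Import all_boot.
From mathcomp Require Import boolp classical_sets functions cardinality.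

Set Implicit Arguments.
Unset Strict Implicit.
Unset Printing Implicit Defensive.

Local Open Scope classical_set_scope.
Local Open Scope card_scope.

(* A hypergraph is given by its vertex type V and its set of edges
   H : set (set V); both V and H may be infinite. *)

Definition uniform (V : Type) (d : nat) (H : set (set V)) : Prop :=
  forall e, H e -> e #= `I_d.

(* The standard convention that every vertex lies on some edge, i.e. that
   there are no isolated vertices. *)
Definition covering (V : Type) (H : set (set V)) : Prop :=
  \bigcup_(e in H) e = [set: V].

Definition balancing_coloring (V : Type) (d : nat) (H : set (set V))
    (c : V -> 'I_d) : Prop :=
  forall e, H e -> ~ exists x y, [/\ e x, e y, x <> y & c x = c y].

Definition balanced (V : Type) (d : nat) (H : set (set V)) : Prop :=
  exists c : V -> 'I_d, balancing_coloring H c.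

(* [A `+` B] is the symmetric difference. *)
Definition strongly_connected (V : Type) (H : set (set V)) : Prop :=
  forall e f, H e -> H f ->
    exists (n : nat) (s : nat -> set V),
      [/\ s 0 = e, s n = f,
          forall i, i <= n -> H (s i) &
          forall i, i < n -> s i `+` s i.+1 #= `I_2].

Definition exact_transversal (V : Type) (H : set (set V)) (T : set V) : Prop :=
  forall e, H e -> exists! x, (T `&` e) x.

Definition color_class (V : Type) (d : nat) (c : V -> 'I_d) (i : 'I_d) : set V :=
  c @^-1` [set i].

(* Main.v *)
Require Import Defs.
From mathcomp Require Import all_boot.
From mathcomp Require Import boolp classical_sets functions cardinality.

(* Every edge carries each color exactly once.  If T is an exact transversal
   and its representatives t, u in two adjacent edges e, f had different colors,
   then t, u and the vertex of f colored like t would be three distinct elements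
   of the symmetric difference of e and f, which has only two.  So by strong
   connectivity all representatives of T share one color, and T is its class. *)

Local Open Scope classical_set_scope.
Local Open Scope card_scope.

Lemma card_eq2_pigeonhole (T : Type) (A : set T) (x y z : T) :
  A #= `I_2 -> A x -> A y -> A z -> [\/ x = y, x = z | y = z].
Proof.
case/card_set_bijP => f [fA f_inj _] Ax Ay Az.
have inj u v : A u -> A v -> f u = f v -> u = v.
  by move=> Au Av; apply: f_inj; rewrite in_setE.
move: (fA _ Ax) (fA _ Ay) (fA _ Az) (inj _ _ Ax Ay) (inj _ _ Ax Az) (inj _ _ Ay Az).
rewrite /mkset.
case: (f x) => [|[|//]]; case: (f y) => [|[|//]]; case: (f z) => [|[|//]] _ _ _ xy xz yz;
  by [apply: Or31; apply: xy | apply: Or32; apply: xz | apply: Or33; apply: yz].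
Qed.

Section BalancingColoring.
Variables (V : Type) (d : nat) (H : set (set V)) (c : V -> 'I_d).
Hypothesis c_balancing : balancing_coloring H c.

Lemma balancing_coloring_inj e x y : H e -> e x -> e y -> c x = c y -> x = y.
Proof.
move=> He ex ey cxy; apply: contrapT => nxy.
by apply: (c_balancing _ He); exists x, y.
Qed.

Hypothesis H_uniform : uniform d H.

(** Numbering the [d] vertices of [e] by ['I_d] turns [c] on [e] into an injective self-map of a
    finite set, hence a bijection. *)
Lemma balancing_coloring_surj e i : H e -> exists2 x, e x & c x = i.
Proof.
move=> He.
have /card_set_bijP[f [_ _ f_surj]] := H_uniform _ He.
have /choice[g ge] : forall k : 'I_d, exists x, e x /\ f x = k.
  by move=> k; have [x ex fx] := f_surj k (ltn_ord k); exists x.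
have cg_inj : injective (fun k => c (g k)).
  move=> k l ckl; have [[ek fk] [el fl]] := (ge k, ge l).
  by apply/val_inj; rewrite /= -fk -fl (balancing_coloring_inj e _ _ He ek el ckl).
by exists (g (invF cg_inj i)); [have [] := ge (invF cg_inj i)|exact: (f_invF cg_inj i)].
Qed.

Lemma color_class_exact_transversal i : exact_transversal H (color_class c i).
Proof.
move=> e He; have [x ex cx] := balancing_coloring_surj e i He.
exists x; split=> [//|y [cy ey]].
by apply: (balancing_coloring_inj e) => //; rewrite cx cy.
Qed.

Lemma exact_transversal_adjacent_color T e f t u :
    exact_transversal H T -> H e -> H f -> e `+` f #= `I_2 ->
  (T `&` e) t -> (T `&` f) u -> c t = c u.
Proof.
move=> T_exact He Hf ef2 [Tt et] [Tu fu]; apply: contrapT => ctu.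
(* If [t] were in [f], it would be the unique point of [T] in [f], namely [u]; symmetrically for [u]
   and [e]. *)
have nft : ~ f t.
  move=> ft; apply: ctu; have [w [_ w_uniq]] := T_exact f Hf.
  by rewrite -(w_uniq t) // -(w_uniq u).
have neu : ~ e u.
  move=> eu; apply: ctu; have [w [_ w_uniq]] := T_exact e He.
  by rewrite -(w_uniq t) // -(w_uniq u).
have [t' ft' ct'] := balancing_coloring_surj f (c t) Hf.
(* The only vertex of [e] colored [c t] is [t], which is not in [f]. *)
have net' : ~ e t'.
  by move=> et'; apply: nft; rewrite -(balancing_coloring_inj e t' t He).
case: (card_eq2_pigeonhole _ _ t u t' ef2); [by left|by right|by right|..].
- by move=> tu; apply: ctu; rewrite tu.
- by move=> tt'; apply: nft; rewrite tt'.
- by move=> ut'; apply: ctu; rewrite ut' ct'.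
Qed.

Hypothesis H_connected : strongly_connected H.

Lemma exact_transversal_color T e f t u :
    exact_transversal H T -> H e -> H f ->
  (T `&` e) t -> (T `&` f) u -> c t = c u.
Proof.
move=> T_exact He Hf Tet; have [n [s [s0 <- Hs s_adj]]] := H_connected e f He Hf.
(* Induction on the length of the path, for all representatives [u] of its last edge. At length 0,
   [t] and [u] represent the same edge and coincide. *)
elim: n u Hs s_adj => [|n IHn] u Hs s_adj Tu.
  have [w [_ w_uniq]] := T_exact e He.
  by rewrite -(w_uniq t) // -(w_uniq u) // -s0.
have [v [Tv _]] := T_exact (s n) (Hs n (leqnSn n)).
rewrite (IHn v) //; first last.
- by move=> i lt_in; apply/s_adj/ltnW.
- by move=> i le_in; apply/Hs/leqW.
apply: exact_transversal_adjacent_color Tv Tu => //.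
- exact/Hs/leqnSn.
- exact: Hs.
- exact: s_adj.
Qed.

Hypothesis H_covering : covering H.

(** Covering places each vertex [x] on an edge [f]. If [x] is in [T], it represents [f] and so has
    color [c t]. If [x] has color [c t], so does the representative of [f], and injectivity of [c]
    on [f] identifies the two. *)
Lemma exact_transversal_color_class T e t :
  exact_transversal H T -> H e -> (T `&` e) t -> T = color_class c (c t).
Proof.
move=> T_exact He Tet; apply/seteqP; split=> x.
all: have [f Hf fx] : (\bigcup_(f in H) f) x by rewrite H_covering.
  by move=> Tx; apply: (exact_transversal_color T f e).
move=> cx; have [u [[Tu fu] _]] := T_exact f Hf.
have ctu : c t = c u by apply: (exact_transversal_color T e f).
by rewrite (balancing_coloring_inj f x u) // -ctu.
Qed.

End BalancingColoring.

Theorem theorem4p3 (V : Type) (d : nat) (H : set (set V))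
    (d_gt0 : 0 < d)
    (H_uniform : uniform d H)
    (H_covering : covering H)
    (H_balanced : balanced d H)
    (H_connected : strongly_connected H)
    (c : V -> 'I_d)
    (c_balancing : balancing_coloring H c) :
  [set T | exact_transversal H T] = [set color_class c i | i in [set: 'I_d]].
Proof.
apply/seteqP; split=> [T /= T_exact|_ [i _ <-]]; last first.
  exact: color_class_exact_transversal.
have [[e He]|noH] := pselect (exists e, H e).
  have [t [Tet _]] := T_exact e He.
  by exists (c t) => //; rewrite -(exact_transversal_color_class _ _ H c _ _ _ _ T e t).
(* Without edges, covering forces V to be empty, and every color class is T. *)
exists (Ordinal d_gt0) => //; apply/seteqP; split=> x.
all: have [e He _] : (\bigcup_(e in H) e) x by rewrite H_covering.
all: by case: noH; exists e.
Qed.
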